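(* Let $H\in(\tfrac12,1)$, let $(L_t)_{t\ge0}$ be a Lévy process without Gaussian component with $\mathbb E L_1=0$, $\mathbb E L_1^2<\infty$, and let $Y_t=\int_0^t z_H(t,s)\,dL_s$ be the fLpMG. Then for all $t>0$, $$\sum_{j=1}^{2^n}\big(Y_{jt/2^n}-Y_{(j-1)t/2^n}\big)^2\to0\quad\text{a.s. as } n\to\infty.$$
   Context: Molchan–Golosov kernel for $H>\tfrac12$: $z_H(t,s)=(H-\tfrac12)c_Hs^{1/2-H}\int_s^t u^{H-1/2}(u-s)^{H-3/2}du$ for $0<s<t$, $0$ otherwise, with $c_H=\frac{1}{\Gamma(H+1/2)}\big(\frac{2H\Gamma(H+1/2)\Gamma(3/2-H)}{\Gamma(2-2H)}\big)^{1/2}$. The integral is the $L^2(\mathbb P)$-limit of integrals of step functions. *)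

(* Defs.v *)
From HB Require Import structures.
From mathcomp Require Import all_boot all_order all_algebra.
From mathcomp Require Import all_classical all_reals all_analysis.
Set Implicit Arguments. Unset Strict Implicit. Unset Printing Implicit Defensive.
Import Order.TTheory GRing.Theory Num.Theory.
Import numFieldNormedType.Exports.
Local Open Scope classical_set_scope.
Local Open Scope ring_scope.

Definition Gamma (R : realType) (x : R) : R :=
  \int[@lebesgue_measure R]_(t in `]0%R, +oo[) (t `^ (x - 1) * expR (- t)).

Definition cH (R : realType) (H : R) : R :=
  (Gamma (H + 1/2))^-1 *
  Num.sqrt (2 * H * Gamma (H + 1/2) * Gamma (3/2 - H) / Gamma (2 - 2 * H)).

Definition zH (R : realType) (H t s : R) : R :=
  if (0 < s) && (s < t) then
    (H - 1/2) * cH H * s `^ (1/2 - H) *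
    \int[@lebesgue_measure R]_(u in `]s, t[) (u `^ (H - 1/2) * (u - s) `^ (H - 3/2))
  else 0.

Definition is_partition (R : realType) (t : R) (n : nat) (p : nat -> R) : Prop :=
  p 0%N = 0 /\ p n = t /\ forall i, (i < n)%N -> p i < p i.+1.

Definition step_fun (R : realType) (n : nat) (p a : nat -> R) (s : R) : R :=
  \sum_(i < n) (if (p i < s) && (s <= p i.+1) then a i else 0).

Definition step_int (R : realType) (T : Type) (X : R -> T -> R)
  (n : nat) (p a : nat -> R) : T -> R :=
  fun w => \sum_(i < n) a i * (X (p i.+1) w - X (p i) w).

Definition wiener_integral (R : realType) (d : measure_display)
  (T : measurableType d) (P : probability T R) (X : R -> T -> R)
  (f : R -> R) (t : R) (Y : T -> R) : Prop :=
  exists (n : nat -> nat) (p a : nat -> nat -> R),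
    (forall k, is_partition t (n k) (p k)) /\
    ((fun k => (\int[@lebesgue_measure R]_(s in `[0%R, t])
        ((step_fun (n k) (p k) (a k) s - f s) ^+ 2)%:E)%E) @ \oo --> (0 : \bar R)) /\
    ((fun k => 'E_P[fun w => ((step_int X (n k) (p k) (a k) w - Y w) ^+ 2)%R]%E)
        @ \oo --> (0 : \bar R)).

Definition levy_process (R : realType) (d : measure_display)
  (T : measurableType d) (P : probability T R) (X : R -> T -> R) : Prop :=
  (forall t, measurable_fun setT (X t)) /\
  [/\ {ae P, forall w, X 0 w = 0},
      (forall (n : nat) (t : nat -> R) (B : nat -> set R),
         0 <= t 0%N -> (forall i, (i < n)%N -> t i <= t i.+1) ->
         (forall i, measurable (B i)) ->
         P (\bigcap_(i in `I_n) [set w | B i (X (t i.+1) w - X (t i) w)]) =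
         (\prod_(i < n) P [set w | B i (X (t i.+1) w - X (t i) w)%R])%E),
      (forall s t (B : set R), 0 <= s -> 0 <= t -> measurable B ->
         P [set w | B (X (s + t) w - X s w)] = P [set w | B (X t w - X 0 w)]),
      (forall t e : R, 0 <= t -> 0 < e ->
         (P [set w | e <= `|X s w - X t w|])
           @[s --> within [set s | 0 <= s] (nbhs t)] --> (0 : \bar R))
    &
      {ae P, forall w, forall t : R, 0 <= t ->
         ((fun s => X s w) @ t^'+ --> X t w) /\
         (0 < t -> exists l : R, (fun s => X s w) @ t^'- --> l)}].

(* Levy--Khintchine representation of L_1 with zero Gaussian coefficient:
   E exp(iuL_1) = exp(i g u + int (e^{iux} - 1 - iux 1_{|x|<1}) nu(dx)),
   written through real and imaginary parts. *)
Definition no_gaussian_component (R : realType) (d : measure_display)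
  (T : measurableType d) (P : probability T R) (X : R -> T -> R) : Prop :=
  exists (g : R) (nu : {measure set R -> \bar R}),
    nu [set 0] = 0%E /\
    nu.-integrable setT (fun x => (Num.min 1 (x ^+ 2))%:E) /\
    forall u : R,
      let A := \int[nu]_x (cos (u * x) - 1) in
      let B := g * u + \int[nu]_x (sin (u * x) - u * x * (if Num.norm x < 1 then 1 else 0)) in
      'E_P[fun w => cos (u * X 1 w)%R]%E = (expR A * cos B)%:E /\
      'E_P[fun w => sin (u * X 1 w)%R]%E = (expR A * sin B)%:E.

(* Main.v *)
(** Put [a = H - 1/2] and write [zH H t v = k v^-a G(t, v)], where [G] is
    nondecreasing and [a]-Hoelder in [t].  Telescoping gives
    [sum_j (zH t_{j+1} v - zH t_j v)^2 <= C v^(-2a) h^a] for a partition of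
    mesh [h], and [v^(-2a)] is integrable near [0] because [2a < 1].
    The process [L - L_0] has covariance [c min(s, t)], so that
    [E (Y_t - Y_s)^2 <= 9 c int (zH t - zH s)^2].  Hence the expected quadratic
    variation at level [n] is at most [C' 2^(-na)]; it is summable in [n], and
    the quadratic variations tend to [0] almost surely. *)
Require Import Defs.
From HB Require Import structures.
From mathcomp Require Import all_boot all_order all_algebra.
From mathcomp Require Import all_classical all_reals all_analysis.
From mathcomp Require Import measurable_realfun ring lra.
Set Implicit Arguments. Unset Strict Implicit. Unset Printing Implicit Defensive.
Import Order.TTheory GRing.Theory Num.Theory.
Import numFieldNormedType.Exports.
Local Open Scope classical_set_scope.
Local Open Scope ring_scope.

(** The Hoelder bound alone is too weak: as [a < 1/2], it only bounds the sum of squared kernel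
    increments over [N] intervals by the order [N * N^(-2a)], which grows. Monotonicity of [G] lets
    one of the two factors telescope, so that a single factor [h^a] is spent and no power of [N] is
    lost. The moments of [L] are given at time 1 only. Stationary independent increments carry
    square integrability to all times and make mean and variance additive in time. An additive
    function that vanishes at a point [p > 0] and is bounded on [[0, p]] is zero, so no
    measurability in time has to be established. Boundedness comes from positivity for the variance,
    and from Chebyshev's inequality with stochastic continuity at 0 for the mean. The integral comes
    with a separate approximating sequence for each time. An increment of [Y] is therefore split
    into three pieces on the probability space, and the kernel increment into three pieces on the
    line; each splitting costs a factor 3, hence the 9. *)

(** * Integrals of powers with an endpoint singularity *)

Lemma integral_powR_shift_closed (R : realType) (s c t b : R) :
  0 < b -> s < c -> c < t ->
  (\int[@lebesgue_measure R]_(u in `[c, t]) ((u - s) `^ (b - 1))%:E =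
   ((t - s) `^ b / b - (c - s) `^ b / b)%:E)%E.
Proof.
move=> b0 sc ct; rewrite EFinB.
have der x : s < x ->
    is_derive x 1 (fun u => (u - s) `^ b / b) ((x - s) `^ (b - 1)).
  move=> sx.
  have xs0 : 0 < x - s by rewrite subr_gt0.
  have dp := is_derive1_powR b xs0.
  have ds : is_derive x 1 (fun u => u - s) 1.
    by apply: is_derive_eq; rewrite subr0.
  have dc := @is_derive1_comp _ (fun y => y `^ b) (fun u => u - s) x _ _ dp ds.
  have := @is_deriveZ _ _ _ _ b^-1 x 1 _ dc.
  move=> dz.
  rewrite [X in is_derive _ _ X _](_ : _ =
    b^-1 \*: ((fun y => y `^ b) \o (fun u => u - s))).
    by apply: is_derive_eq dz _; rewrite /GRing.scale /= mulr1 mulrA mulVf ?gt_eqF// mul1r.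
  by apply/funext => u /=; rewrite /GRing.scale /= mulrC.
apply: (@continuous_FTC2 _ _ (fun u => (u - s) `^ b / b)) => //.
- apply: continuous_in_subspaceT => x; rewrite inE/= in_itv/= => /andP[cx _].
  have sx := lt_le_trans sc cx.
  have xs0 : 0 < x - s by rewrite subr_gt0.
  have dp := is_derive1_powR (b - 1) xs0.
  have cp : {for x - s, continuous (fun y : R => y `^ (b - 1))}.
    apply: differentiable_continuous; apply/derivable1_diffP.
    by case: dp.
  apply: (@continuous_comp _ _ _ (fun u => u - s) (fun y => y `^ (b - 1))) => //.
  by apply: cvgB => //; exact: cvg_cst.
- have cF x : s < x -> {for x, continuous (fun u => (u - s) `^ b / b)}.
    move=> sx; apply: differentiable_continuous; apply/derivable1_diffP.
    by case: (der _ sx).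
  split.
  + move=> x; rewrite in_itv/= => /andP[cx _].
    by case: (der x (lt_trans sc cx)).
  + by apply: cvg_at_right_filter; exact: cF.
  + by apply: cvg_at_left_filter; apply: cF; exact: lt_trans ct.
- move=> x; rewrite in_itv/= => /andP[cx _].
  by rewrite derive1E; case: (der x (lt_trans sc cx)).
Qed.

Lemma measurable_powR_shift (R : realType) (s b : R) (D : set R) :
  measurable_fun D (fun u : R => (u - s) `^ b).
Proof.
apply: (measurableT_comp (measurable_powR b)).
by apply: measurable_funB => //; exact: measurable_cst.
Qed.

(** The integrand blows up at [s] when [b < 1], so the closed formula is used on [[s + 1/(n+1), t]],
    where its subtracted endpoint term is dropped, and monotone convergence exhausts []s, t[]. *)
Lemma integral_powR_shift_le (R : realType) (s t b : R) :
  0 < b ->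
  (\int[@lebesgue_measure R]_(u in `]s, t[) ((u - s) `^ (b - 1))%:E <=
   ((t - s) `^ b / b)%:E)%E.
Proof.
move=> b0.
pose f u := (((u - s) `^ (b - 1))%:E : \bar R).
have mf D : measurable_fun D f by apply/measurable_EFinP; exact: measurable_powR_shift.
have f0 u : (0 <= f u)%E by rewrite lee_fin powR_ge0.
pose F (n : nat) : set R := `[s + n.+1%:R^-1, t]%classic.
have FU : `]s, t[%classic `<=` \bigcup_n F n.
  move=> x /=; rewrite in_itv/= => /andP[sx xt].
  have [n hn] := ltr_add_invr sx.
  by exists n => //; rewrite /F /= in_itv/= (ltW hn) (ltW xt).
have mF n : measurable (F n) by exact: measurable_itv.
have nF : nondecreasing_seq F.
  move=> m n mn; rewrite subsetEset => x; rewrite /F /= !in_itv/= => /andP[h ->].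
  by rewrite andbT; apply: le_trans h; rewrite lerD2l lef_pV2 ?posrE// ler_nat ltnS.
apply: (@le_trans _ _ (\int[@lebesgue_measure R]_(u in \bigcup_n F n) f u)%E).
  apply: ge0_subset_integral => //.
  - by apply: bigcup_measurable => n _; exact: mF.
  - exact: mf.
  - by move=> x _; exact: f0.
have := ge0_nondecreasing_set_cvg_integral (mu := lebesgue_measure) nF mF
  (fun n => mf (F n)) (fun n x _ => f0 x).
move=> cF; rewrite -(cvg_lim _ cF)//; apply: lime_le; first exact: cvgP cF.
apply: nearW => n.
have [h|h] := ltP (s + n.+1%:R^-1) t.
  rewrite integral_powR_shift_closed ?ltrDl ?invr_gt0//.
  by rewrite lee_fin gerBl divr_ge0 ?powR_ge0// ltW.
(* For these [n] the interval has degenerated to at most one point. *)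
rewrite (integral_Sset1 (s + n.+1%:R^-1)) ?lee_fin ?divr_ge0 ?powR_ge0 ?(ltW b0)//.
move=> x; rewrite /F /= in_itv/= => /andP[h1 h2]; apply/eqP.
by rewrite eq_le h1 (le_trans h2 h).
Qed.

(** * The kernel and its increments in time *)

Definition kernel_integrand (R : realType) (a v u : R) : R :=
  u `^ a * (u - v) `^ (a - 1).

Definition kernel_integral (R : realType) (a t v : R) : R :=
  \int[@lebesgue_measure R]_(u in `]v, t[) kernel_integrand a v u.

Lemma kernel_integrand_ge0 (R : realType) (a v u : R) : 0 <= kernel_integrand a v u.
Proof. by rewrite mulr_ge0 ?powR_ge0. Qed.

Lemma measurable_kernel_integrand (R : realType) (a v : R) (D : set R) :
  measurable_fun D (fun u => (kernel_integrand a v u)%:E).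
Proof.
apply/measurable_EFinP; apply: measurable_funM; last exact: measurable_powR_shift.
by apply: measurable_funS (measurable_powR a).
Qed.

(** Since [a - 1 < 0] and [v <= s], moving the singularity from [v] to [s] only enlarges the
    integrand, and [u^a <= T^a]. The resulting bound is uniform in [v]. *)
Lemma integral_kernel_integrand_le (R : realType) (a s t T v : R) :
  0 < a < 1 -> 0 <= v -> v <= s -> t <= T ->
  (\int[@lebesgue_measure R]_(u in `]s, t[) (kernel_integrand a v u)%:E <=
   (T `^ a * ((t - s) `^ a / a))%:E)%E.
Proof.
move=> /andP[a0 a1] v0 vs tT.
apply: (@le_trans _ _ (\int[@lebesgue_measure R]_(u in `]s, t[)
    ((T `^ a)%:E * ((u - s) `^ (a - 1))%:E))%E).
  apply: ge0_le_integral => //.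
  - by move=> u _; rewrite lee_fin kernel_integrand_ge0.
  - exact: measurable_kernel_integrand.
  - apply: measurable_funeM; apply/measurable_EFinP; exact: measurable_powR_shift.
  - move=> u /=; rewrite in_itv/= => /andP[su ut].
    have v_u : v < u by exact: le_lt_trans su.
    have u0 : 0 < u by exact: le_lt_trans v_u.
    rewrite -EFinM lee_fin; apply: ler_pM; rewrite ?powR_ge0//.
      by rewrite ge0_ler_powR ?nnegrE ?(ltW a0)// ?(ltW u0)// ?(le_trans (ltW u0))//;
        rewrite (le_trans (ltW ut)).
    rewrite -[a - 1]opprB !powRN lef_pV2 ?posrE ?powR_gt0 ?subr_gt0//.
    by rewrite ge0_ler_powR ?nnegrE ?subr_ge0 ?(ltW a1) ?(ltW su) ?(ltW v_u)// lerD2l lerN2.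
rewrite ge0_integralZl//; last 3 first.
- by apply/measurable_EFinP; exact: measurable_powR_shift.
- by move=> u _; rewrite lee_fin powR_ge0.
- by rewrite lee_fin powR_ge0.
by rewrite EFinM lee_pmul// ?lee_fin ?powR_ge0 ?integral_powR_shift_le//;
  apply: integral_ge0 => u _; rewrite lee_fin powR_ge0.
Qed.

Lemma integrable_kernel_integrand (R : realType) (a s t v : R) :
  0 < a < 1 -> 0 <= v -> v <= s ->
  (@lebesgue_measure R).-integrable `]s, t[ (EFin \o kernel_integrand a v).
Proof.
move=> a01 v0 vs; apply/integrableP; split.
  exact: measurable_kernel_integrand.
under eq_integral do rewrite /= ger0_norm ?kernel_integrand_ge0//.
by apply: le_lt_trans (integral_kernel_integrand_le a01 v0 vs (lexx t)) _; rewrite ltry.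
Qed.

Lemma kernel_integral_out (R : realType) (a t v : R) : t <= v -> kernel_integral a t v = 0.
Proof. by move=> tv; rewrite /kernel_integral set_itv_ge ?Rintegral_set0// bnd_simp -leNgt. Qed.

Lemma le_fine_EFin (R : realType) (x : \bar R) (y : R) :
  (0 <= x)%E -> (x <= y%:E)%E -> fine x <= y.
Proof. by case: x => [x|//|//] _; rewrite lee_fin. Qed.

Lemma kernel_integral_ge0 (R : realType) (a t v : R) : 0 <= kernel_integral a t v.
Proof. by apply: Rintegral_ge0 => u _; exact: kernel_integrand_ge0. Qed.

Lemma kernel_integral_bound (R : realType) (a t T v : R) :
  0 < a < 1 -> 0 <= v -> t <= T ->
  kernel_integral a t v <= T `^ a * ((t - v) `^ a / a).
Proof.
move=> a01 v0 tT; apply: le_fine_EFin.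
  by apply: integral_ge0 => u _; rewrite lee_fin kernel_integrand_ge0.
exact: integral_kernel_integrand_le.
Qed.

(** If [v < s], the increment is an integral over []s, t[], to which the uniform bound applies. If
    [s <= v], the earlier value is 0 and the later one is controlled by [(t - v)^a <= (t - s)^a]. *)
Lemma kernel_integral_increment (R : realType) (a s t T v : R) :
  0 < a < 1 -> 0 <= v -> s <= t -> t <= T ->
  0 <= kernel_integral a t v - kernel_integral a s v <=
  T `^ a * ((t - s) `^ a / a).
Proof.
move=> a01 v0 st tT; have /andP[a0 a1] := a01.
have [->|st'] := eqVneq s t.
  by rewrite !subrr lexx mulr_ge0 ?divr_ge0 ?powR_ge0// ltW.
have [sv|vs] := leP s v.
  rewrite (kernel_integral_out _ sv) subr0 kernel_integral_ge0 /=.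
  have [tv|vt] := leP t v.
    by rewrite (kernel_integral_out _ tv) mulr_ge0 ?divr_ge0 ?powR_ge0// ltW.
  apply: le_trans (kernel_integral_bound a01 v0 tT) _.
  rewrite ler_wpM2l ?powR_ge0// ler_wpM2r ?invr_ge0 ?(ltW a0)//.
  by rewrite ge0_ler_powR ?nnegrE ?subr_ge0 ?(ltW a0) ?(ltW vt)// lerD2l lerN2.
have hB : kernel_integral a t v - kernel_integral a s v =
    \int[@lebesgue_measure R]_(u in `]s, t[) kernel_integrand a v u.
  rewrite /kernel_integral [X in _ - X]Rintegral_itv_bndo_bndc; last first.
    exact: integrable_kernel_integrand.
  apply: Rintegral_itvB; rewrite ?bnd_simp ?(ltW vs) ?lt_neqAle ?st'//.
  exact: integrable_kernel_integrand.
rewrite hB; apply/andP; split.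
  by apply: Rintegral_ge0 => u _; exact: kernel_integrand_ge0.
apply: le_fine_EFin.
  by apply: integral_ge0 => u _; rewrite lee_fin kernel_integrand_ge0.
by apply: integral_kernel_integrand_le => //; exact: ltW.
Qed.

(** The variable [v] enters both the integrand and the domain. Encoding the domain as an indicator
    on the plane turns the integral into a partial integral of a nonnegative jointly measurable
    function, to which Tonelli applies. *)
Lemma measurable_kernel_integral (R : realType) (a t : R) :
  measurable_fun setT (kernel_integral a t).
Proof.
pose f (x : R * R) : \bar R :=
  ((kernel_integrand a x.1 x.2)%:E * (\1_[set x : R * R | x.1 < x.2 < t] x)%:E)%E.
have mf : measurable_fun setT f.
  apply: emeasurable_funM.
    apply/measurable_EFinP; apply: measurable_funM.
      exact: (measurableT_comp (measurable_powR a)).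
    apply: (measurableT_comp (measurable_powR (a - 1))).
    by apply: measurable_funB.
  apply/measurable_EFinP; apply: measurable_indic.
  rewrite (_ : [set _ | _] = [set x : R * R | x.1 < x.2] `&` [set x | x.2 < t]).
    apply: measurableI.
      have := @measurable_fun_ltr _ (R * R)%type R setT fst snd measurable_fst measurable_snd.
      by move=> /(_ measurableT [set true] I); rewrite setTI.
    have := @measurable_fun_ltr _ (R * R)%type R setT snd (cst t) measurable_snd (measurable_cst _).
    by move=> /(_ measurableT [set true] I); rewrite setTI.
  by apply/seteqP; split => x /= => [/andP|[-> ->]].
have f0 x : (0 <= f x)%E.
  by rewrite mule_ge0// lee_fin ?kernel_integrand_ge0.
have mF := measurable_fun_fubini_tonelli_F (m2 := @lebesgue_measure R) f mf f0.
rewrite (_ : kernel_integral a t = fine \o fubini_F (@lebesgue_measure R) f).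
  by apply: measurableT_comp mF.
apply/funext => v; rewrite /kernel_integral /Rintegral /= /fubini_F.
congr (fine _); rewrite [LHS]integral_mkcond; apply: eq_integral => u _.
rewrite /f /= patchE indicE; case: ifPn => h.
  by rewrite mem_set ?mule1//; move: h; rewrite inE/= in_itv.
by rewrite memNset ?mule0//= => h'; move: h; rewrite notin_setE/= in_itv/= h'.
Qed.

(** With [a = H - 1/2] the exponents [1/2 - H] and [H - 3/2] become [-a] and [a - 1]. The cutoff
    [v < t] is absorbed, because an empty interval has integral 0. *)
Lemma zHE (R : realType) (H t v : R) :
  zH H t v = if 0 < v then (H - 1/2) * cH H * v `^ (- (H - 1/2)) *
    kernel_integral (H - 1/2) t v else 0.
Proof.
rewrite /zH; case: ltP => //= v0; case: ltP => [vt|tv]; last first.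
  by rewrite kernel_integral_out// mulr0.
rewrite opprB /kernel_integral /kernel_integrand.
by have -> : H - 1/2 - 1 = H - 3/2 by lra.
Qed.

Lemma zH_out (R : realType) (H t v : R) : (v <= 0) || (t <= v) -> zH H t v = 0.
Proof. by rewrite /zH !leNgt -negb_and => /negbTE ->. Qed.

Lemma measurable_zH (R : realType) (H t : R) : measurable_fun setT (zH H t).
Proof.
rewrite (_ : zH H t = fun v => if 0 < v then (H - 1/2) * cH H *
    v `^ (- (H - 1/2)) * kernel_integral (H - 1/2) t v else 0); last first.
  by apply/funext => v; rewrite zHE.
apply: measurable_fun_ifT.
- exact: measurable_fun_ltr.
- apply: measurable_funM; last exact: measurable_kernel_integral.
  by apply: measurable_funM => //; exact: measurable_powR.
- exact: measurable_cst.
Qed.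

(** * Squared kernel increments summed over a uniform partition *)

Lemma sum_sqr_increment_le (R : realDomainType) (N : nat) (g : nat -> R) (M : R) :
  (forall j, (j < N)%N -> 0 <= g j.+1 - g j <= M) ->
  \sum_(j < N) (g j.+1 - g j) ^+ 2 <= M * (g N - g 0%N).
Proof.
move=> h; rewrite -(telescope_sumr _ (leq0n N)) big_mkord mulr_sumr.
apply: ler_sum => j _; have /andP[h0 hM] := h j (ltn_ord j).
by rewrite expr2 ler_wpM2r.
Qed.

(** The factor [v^(-a)] is common to all increments and leaves the sum squared; the remaining
    increments telescope. The exponent [-2a] is written [(1 - 2a) - 1] to match the power integral
    with [b = 1 - 2a]. *)
Lemma sum_sqr_zH_le (R : realType) (H T v : R) (N : nat) :
  1/2 < H < 1 -> 0 < T -> (0 < N)%N ->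
  \sum_(j < N) (zH H (j.+1%:R * T / N%:R) v - zH H (j%:R * T / N%:R) v) ^+ 2 <=
  ((H - 1/2) * cH H) ^+ 2 * (T `^ (H - 1/2) * ((T / N%:R) `^ (H - 1/2) / (H - 1/2))) *
  (T `^ (H - 1/2) * (T `^ (H - 1/2) / (H - 1/2))) *
  (if 0 < v < T then v `^ (1 - 2 * (H - 1/2) - 1) else 0).
Proof.
move=> /andP[H0 H1] T0 N0.
have NR : (0 : R) < N%:R by rewrite ltr0n.
pose p (j : nat) := j%:R * T / N%:R.
have pT j : (j <= N)%N -> p j <= T.
  by move=> jN; rewrite /p mulrAC ler_piMl ?(ltW T0)// ler_pdivrMr// mul1r ler_nat.
case: ifPn => [/andP[v0 vT]|vout]; last first.
  have zo j : (j <= N)%N -> zH H (p j) v = 0.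
    move=> jN; rewrite zH_out//.
    move: vout; rewrite negb_and -!leNgt => /orP[->//|Tv].
    by rewrite (le_trans (pT _ jN) Tv) orbT.
  rewrite mulr0 big1// => j _.
  by rewrite -/(p j.+1) -/(p j) !zo ?subrr ?expr0n// ltnW.
set a := H - 1/2.
have a01 : 0 < a < 1 by rewrite /a; apply/andP; split; lra.
have a0 : 0 < a by case/andP: a01.
have v0' := ltW v0.
pose g (j : nat) := kernel_integral a (p j) v.
pose M := T `^ a * ((T / N%:R) `^ a / a).
have M0 : 0 <= M by rewrite mulr_ge0 ?divr_ge0 ?powR_ge0// ltW.
have gM j : (j < N)%N -> 0 <= g j.+1 - g j <= M.
  move=> jN.
  have pp : p j.+1 - p j = T / N%:R.
    by rewrite /p -mulrBl -mulrBl -natr1 addrAC subrr add0r mul1r.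
  rewrite /M -pp; apply: kernel_integral_increment => //; last exact: pT.
  by rewrite -subr_ge0 pp divr_ge0// ltW.
rewrite (eq_bigr (fun j : 'I_N => (a * cH H * v `^ (- a)) ^+ 2 *
    (g j.+1 - g j) ^+ 2)); last first.
  by move=> j _; rewrite !zHE v0 -/a -exprMn mulrBr.
rewrite -mulr_sumr.
apply: (@le_trans _ _ ((a * cH H * v `^ (- a)) ^+ 2 * (M * (g N - g 0%N)))).
  by rewrite ler_wpM2l ?sqr_ge0//; exact: sum_sqr_increment_le.
(* One [T^a] bounds [u^a], the other bounds [(T - v)^a]; the term at index 0 vanishes. *)
have gN : g N - g 0%N <= T `^ a * (T `^ a / a).
  rewrite /g [X in _ - X]kernel_integral_out ?subr0; last by rewrite /p !mul0r.
  apply: le_trans (kernel_integral_bound a01 v0' (pT _ (leqnn N))) _.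
  rewrite ler_wpM2l ?powR_ge0// ler_wpM2r ?invr_ge0 ?(ltW a0)//.
  have -> : p N = T by rewrite /p mulrAC divff ?gt_eqF// mul1r.
  apply: ge0_ler_powR; rewrite ?nnegrE ?(ltW a0) ?subr_ge0 ?(ltW vT) ?(ltW T0)//.
  by rewrite lerBlDr lerDl.
have -> : 1 - 2 * a - 1 = - a + - a by ring.
rewrite [v `^ (- a - a)]powRD ?(gt_eqF v0) ?implybT//.
pose X := (a * cH H) ^+ 2 * M * (v `^ (- a) * v `^ (- a)).
rewrite [leLHS](_ : _ = X * (g N - g 0%N)); last by rewrite /X; ring.
rewrite [leRHS](_ : _ = X * (T `^ a * (T `^ a / a))); last by rewrite /X -/M mulrAC.
rewrite ler_wpM2l//; apply: mulr_ge0; last by rewrite mulr_ge0 ?powR_ge0.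
by rewrite mulr_ge0 ?sqr_ge0.
Qed.

Lemma integral_sum_sqr_zH_le (R : realType) (H T : R) :
  1/2 < H < 1 -> 0 < T -> exists2 C : R, 0 <= C &
  forall N, (0 < N)%N ->
  (\int[@lebesgue_measure R]_v
    (\sum_(j < N) (zH H (j.+1%:R * T / N%:R) v - zH H (j%:R * T / N%:R) v) ^+ 2)%:E
   <= (C * (N%:R^-1) `^ (H - 1/2))%:E)%E.
Proof.
move=> H01 T0; have /andP[H0 H1] := H01.
set a := H - 1/2.
have a01 : 0 < a < 1/2 by rewrite /a; apply/andP; split; lra.
have /andP[a0 a1] := a01.
have b0 : 0 < 1 - 2 * a by lra.
pose K N := (a * cH H) ^+ 2 * (T `^ a * ((T / N%:R) `^ a / a)) *
  (T `^ a * (T `^ a / a)).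
have K0 N : 0 <= K N.
  by apply: mulr_ge0; first (apply: mulr_ge0; first exact: sqr_ge0);
    rewrite mulr_ge0 ?divr_ge0 ?powR_ge0// ltW.
(* This is [K N] with [(1/N)^a] taken out of [(T/N)^a], times the bound for the integral of
   [v^(-2a)] over []0, T[]. *)
exists ((a * cH H) ^+ 2 * (T `^ a * (T `^ a / a)) * (T `^ a * (T `^ a / a)) *
    (T `^ (1 - 2 * a) / (1 - 2 * a))).
  apply: mulr_ge0; last by rewrite divr_ge0 ?powR_ge0// ltW.
  by apply: mulr_ge0; first (apply: mulr_ge0; first exact: sqr_ge0);
    rewrite mulr_ge0 ?divr_ge0 ?powR_ge0// ltW.
move=> N N0.
pose f v := (((v - 0) `^ (1 - 2 * a - 1))%:E : \bar R).
have mf D : measurable_fun D f.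
  by apply/measurable_EFinP; exact: measurable_powR_shift.
have mfT : measurable_fun setT (f \_ `]0, T[).
  by apply/(measurable_restrictT f) => //; exact: mf.
pose h (v : R) := ((K N)%:E * (f \_ `]0%R, T[) v)%E.
apply: (@le_trans _ _ (\int[@lebesgue_measure R]_v h v)%E).
  apply: ge0_le_integral => //.
  - by move=> v _; rewrite lee_fin sumr_ge0// => j _; rewrite sqr_ge0.
  - apply/measurable_EFinP; apply: measurable_sum => j.
    by apply: measurable_funX; apply: measurable_funB; exact: measurable_zH.
  - exact: measurable_funeM.
  - move=> v _; rewrite /h patchE /f subr0.
    have := @sum_sqr_zH_le R H T v N H01 T0 N0.
    rewrite -/a -/(K N); case: ifPn => vT hs.
      by rewrite mem_set ?lee_fin//= in_itv.
    rewrite memNset; last by rewrite /= in_itv/=; exact/negP.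
    by rewrite mule0 lee_fin; move: hs; rewrite mulr0.
rewrite /h ge0_integralZl//; last 2 first.
- by move=> v _; rewrite patchE; case: ifP => // _; rewrite lee_fin powR_ge0.
- by rewrite lee_fin.
rewrite -integral_mkcond.
apply: (@le_trans _ _ ((K N)%:E * ((T - 0) `^ (1 - 2 * a) / (1 - 2 * a))%:E)%E).
  by rewrite lee_wpmul2l ?lee_fin// integral_powR_shift_le.
rewrite subr0 -EFinM lee_fin /K powRM ?invr_ge0 ?(ltW T0)//.
by rewrite le_eqVlt; apply/orP; left; apply/eqP; ring.
Qed.

(** * Square-integrable variables, independence and equality in law *)

Definition square_integrable (R : realType) (d : measure_display)
    (T : measurableType d) (P : probability T R) (X : T -> R) : Prop :=
  measurable_fun setT X /\ P.-integrable setT (fun w => (X w ^+ 2)%:E).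

Section SquareIntegrable.
Context (R : realType) (d : measure_display) (T : measurableType d).
Context (P : probability T R).
Implicit Types X Y : T -> R.

Lemma square_integrable_le X Y : measurable_fun setT X ->
  (forall w, `|X w| <= `|Y w|) -> square_integrable P Y -> square_integrable P X.
Proof.
move=> mX XY [mY iY]; split => //.
apply: (le_integrable measurableT _ _ iY).
  by apply/measurable_EFinP; exact: measurable_funX.
by move=> w _; rewrite /= lee_fin !normrX lerXn2r ?nnegrE.
Qed.

Lemma square_integrable_mul X Y : square_integrable P X -> square_integrable P Y ->
  P.-integrable setT (EFin \o (fun w => X w * Y w)).
Proof.
move=> [mX iX] [mY iY].
apply: (le_integrable measurableT _ _ (integrableD measurableT iX iY)).
  by apply/measurable_EFinP; exact: measurable_funM.
move=> w _; rewrite /= lee_fin [leRHS]ger0_norm ?addr_ge0 ?sqr_ge0//.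
rewrite normrM -[X w ^+ 2]real_normK ?num_real// -[Y w ^+ 2]real_normK ?num_real//.
have := sqr_ge0 (`|X w| - `|Y w|); have := normr_ge0 (X w); have := normr_ge0 (Y w).
nra.
Qed.

Lemma square_integrable_cst (c : R) : square_integrable P (cst c).
Proof.
by split=> //; exact: (finite_measure_integrable_cst P (c ^+ 2) measurableT).
Qed.

Lemma square_integrable_integrable X : square_integrable P X ->
  P.-integrable setT (EFin \o X).
Proof.
move=> hX; have := square_integrable_mul hX (square_integrable_cst 1).
by apply: eq_integrable => // w _; rewrite /= mulr1.
Qed.

Lemma square_integrableD X Y : square_integrable P X -> square_integrable P Y ->
  square_integrable P (fun w => X w + Y w).
Proof.
move=> hX hY; have [mX iX] := hX; have [mY iY] := hY; split.
  exact: measurable_funD.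
have iXY := integrableZl measurableT 2 (square_integrable_mul hX hY).
have := integrableD measurableT (integrableD measurableT iX iY) iXY.
apply: eq_integrable => // w _ /=.
by rewrite -EFinM -!EFinD; congr EFin; ring.
Qed.

Lemma square_integrableZ (c : R) X : square_integrable P X ->
  square_integrable P (fun w => c * X w).
Proof.
move=> [mX iX]; split; first exact: measurable_funM.
have := integrableZl measurableT (c ^+ 2) iX.
by apply: eq_integrable => // w _ /=; rewrite -EFinM exprMn.
Qed.

Lemma square_integrableB X Y : square_integrable P X -> square_integrable P Y ->
  square_integrable P (fun w => X w - Y w).
Proof.
move=> hX hY; have := square_integrableD hX (square_integrableZ (-1) hY).
by under eq_fun do rewrite mulN1r.
Qed.

Lemma Rintegral_cstP (c : R) : \int[P]_w c = c.
Proof.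
have := Rintegral_cst P measurableT c.
by rewrite /= => ->; rewrite probability_setT mulr1.
Qed.

Definition independent X Y := forall A B : set R, measurable A -> measurable B ->
  (P (X @^-1` A `&` Y @^-1` B) = P (X @^-1` A) * P (Y @^-1` B))%E.

(** Independence identifies the law of the pair with the product of the marginal laws on rectangles,
    hence everywhere by uniqueness of product measures; Tonelli then factors the integral, infinite
    values included. *)
Lemma ge0_integral_independent X Y (f g : R -> R) :
  measurable_fun setT X -> measurable_fun setT Y -> independent X Y ->
  measurable_fun setT f -> measurable_fun setT g ->
  (forall x, 0 <= f x) -> (forall x, 0 <= g x) ->
  (\int[P]_w (f (X w) * g (Y w))%:E =
   \int[P]_w (f (X w))%:E * \int[P]_w (g (Y w))%:E)%E.
Proof.
move=> mX mY XY mf mg f0 g0.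
have mZ : measurable_fun setT (fun w => (X w, Y w)) by exact: measurable_fun_pair.
pose X' : {RV P >-> R} := mfun_Sub (mem_set mX).
pose Y' : {RV P >-> R} := mfun_Sub (mem_set mY).
pose Z' : {RV P >-> (R * R)%type} := mfun_Sub (mem_set mZ).
have E : forall A, measurable A ->
    (distribution P X' \x distribution P Y')%E A = distribution P Z' A.
  by apply: product_measure_unique => A B mA mB; exact: XY.
pose h (z : R * R) : \bar R := ((f z.1)%:E * (g z.2)%:E)%E.
have mh : measurable_fun setT h.
  by apply: emeasurable_funM; apply/measurable_EFinP;
    [exact: (measurableT_comp mf)|exact: (measurableT_comp mg)].
have h0 z : (0 <= h z)%E by rewrite mule_ge0 ?lee_fin.
have mfE : measurable_fun setT (EFin \o f) by exact/measurable_EFinP.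
have mgE : measurable_fun setT (EFin \o g) by exact/measurable_EFinP.
have := ge0_integral_distribution Z' mh h0.
rewrite -(eq_measure_integral _ (fun A mA _ => E A mA)).
rewrite fubini_tonelli1// => HZ.
transitivity (\int[P]_w (h \o Z') w)%E.
  by apply: eq_integral => w _; rewrite /h /= EFinM.
rewrite -HZ.
transitivity (\int[distribution P X']_x
   ((\int[distribution P Y']_y (g y)%:E) * (f x)%:E))%E.
  apply: eq_integral => x _; rewrite /fubini_F /h /= ge0_integralZl//.
  - by rewrite muleC.
  - by move=> y _; rewrite lee_fin.
  - by rewrite lee_fin.
rewrite ge0_integralZl//; last 2 first.
- by move=> x _; rewrite lee_fin.
- by apply: integral_ge0 => y _; rewrite lee_fin.
rewrite muleC; congr (_ * _)%E.
- by rewrite (ge0_integral_distribution X' (f := EFin \o f)).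
- by rewrite (ge0_integral_distribution Y' (f := EFin \o g)).
Qed.

(** As [fine] sends [+oo] to 0, both sides are 0 once a factor is infinite. *)
Lemma ge0_fineM (x y : \bar R) : (0 <= x)%E -> (0 <= y)%E ->
  fine (x * y)%E = fine x * fine y.
Proof.
case: x y => [x| |] [y| |] //= x0 y0.
- have [->|xn] := eqVneq x 0; first by rewrite mul0e mul0r.
  by rewrite gt0_muley ?mulr0// lt0e x0 andbT eqe.
- have [->|yn] := eqVneq y 0; first by rewrite mule0 mulr0.
  by rewrite gt0_mulye ?mul0r// lt0e y0 andbT eqe.
- by rewrite mulr0.
Qed.

Lemma Rintegral_independent X Y (f g : R -> R) :
  measurable_fun setT X -> measurable_fun setT Y -> independent X Y ->
  measurable_fun setT f -> measurable_fun setT g ->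
  (forall x, 0 <= f x) -> (forall x, 0 <= g x) ->
  \int[P]_w (f (X w) * g (Y w)) = \int[P]_w f (X w) * \int[P]_w g (Y w).
Proof.
move=> mX mY XY mf mg f0 g0.
by rewrite /Rintegral ge0_integral_independent// ge0_fineM//;
  apply: integral_ge0 => w _; rewrite lee_fin.
Qed.

(** Positive and negative parts reduce the claim to four nonnegative products; square integrability
    makes each of them integrable, so that they may be recombined. *)
Lemma Rintegral_independent_mul X Y :
  square_integrable P X -> square_integrable P Y -> independent X Y ->
  \int[P]_w (X w * Y w) = \int[P]_w X w * \int[P]_w Y w.
Proof.
move=> hX hY XY; have [mX _] := hX; have [mY _] := hY.
pose pos (x : R) := Num.max x 0; pose neg (x : R) := Num.max (- x) 0.
have mpos : measurable_fun setT pos by exact: measurable_maxr.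
have mneg : measurable_fun setT neg by apply: measurable_maxr => //; exact: measurable_oppr.
have pos0 x : 0 <= pos x by rewrite le_max lexx orbT.
have neg0 x : 0 <= neg x by rewrite le_max lexx orbT.
have pnE x : x = pos x - neg x.
  by rewrite /pos /neg; case: (lerP x 0) => x0; case: (lerP (- x) 0) => x1; lra.
have posle x : `|pos x| <= `|x|.
  rewrite ger0_norm// /pos; case: (lerP x 0) => x0 //; exact: ler_norm.
have negle x : `|neg x| <= `|x|.
  by rewrite ger0_norm// /neg; case: (lerP (- x) 0) => x0 //; rewrite -normrN ler_norm.
have sp Z : square_integrable P Z -> square_integrable P (pos \o Z).
  move=> hZ; apply: square_integrable_le (hZ) => [|w]; last exact: posle.
  by case: hZ => mZ _; exact: (measurableT_comp mpos).
have sn Z : square_integrable P Z -> square_integrable P (neg \o Z).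
  move=> hZ; apply: square_integrable_le (hZ) => [|w]; last exact: negle.
  by case: hZ => mZ _; exact: (measurableT_comp mneg).
have split_int Z : square_integrable P Z ->
    \int[P]_w Z w = \int[P]_w pos (Z w) - \int[P]_w neg (Z w).
  move=> hZ; rewrite -RintegralB//; last 2 first.
  - exact: (square_integrable_integrable (sp _ hZ)).
  - exact: (square_integrable_integrable (sn _ hZ)).
  by apply: eq_Rintegral => w _; exact: pnE.
have i f g : square_integrable P f -> square_integrable P g ->
    P.-integrable setT (EFin \o (fun w => f w * g w)) := @square_integrable_mul f g.
transitivity (\int[P]_w ((pos (X w) * pos (Y w) - pos (X w) * neg (Y w)) -
    (neg (X w) * pos (Y w) - neg (X w) * neg (Y w)))).
  by apply: eq_Rintegral => w _; rewrite {1}(pnE (X w)) {1}(pnE (Y w)); ring.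
have ipp := i _ _ (sp _ hX) (sp _ hY); have ipn := i _ _ (sp _ hX) (sn _ hY).
have inp := i _ _ (sn _ hX) (sp _ hY); have inn := i _ _ (sn _ hX) (sn _ hY).
rewrite RintegralB//; last 2 first.
- by apply: eq_integrable (integrableB measurableT ipp ipn).
- by apply: eq_integrable (integrableB measurableT inp inn).
rewrite !RintegralB// !Rintegral_independent//.
rewrite (split_int _ hX) (split_int _ hY); ring.
Qed.

(* Where [|Y| <= M], [X^2 <= 2 (X + Y)^2 + 2 M^2]; independence factors the
   positive probability of that event out of the left-hand side. *)
Lemma square_integrable_independentD X Y :
  measurable_fun setT X -> measurable_fun setT Y -> independent X Y ->
  square_integrable P (fun w => X w + Y w) -> square_integrable P X.
Proof.
move=> mX mY XY [mXY iXY]; split => //.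
have mA (n : nat) : measurable [set w | `|Y w| <= n%:R].
  have := @measurable_fun_ler _ T R setT (Num.norm \o Y) (cst n%:R).
  move=> /(_ (measurableT_comp (@normr_measurable R setT) mY) (measurable_cst _)).
  by move=> /(_ measurableT [set true] I); rewrite setTI.
have [M PM] : exists M : nat, (0 < P [set w | (`|Y w| <= M%:R)%R])%E.
  apply: contrapT => /forallNP h.
  have : P setT = 0%E; last by rewrite probability_setT => /eqP; rewrite onee_eq0.
  apply: measure_negligible => //.
  have -> : [set: T] = \bigcup_n [set w | `|Y w| <= n%:R].
    apply/seteqP; split => // w _.
    by exists (Num.bound `|Y w|) => //=; rewrite ltW// archi_boundP.
  apply: negligible_bigcup => n; apply/negligibleP => //.
  by apply/eqP; rewrite -measure_le0 leNgt; exact/negP/h.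
pose g (y : R) : R := \1_[set y : R | `|y| <= M%:R] y.
have mg : measurable_fun setT g.
  apply: measurable_indic.
  have := @measurable_fun_ler _ _ R setT (@Num.norm _ R) (cst M%:R).
  move=> /(_ (@normr_measurable R setT) (measurable_cst _)).
  by move=> /(_ measurableT [set true] I); rewrite setTI.
have g0 y : 0 <= g y by rewrite /g indicE.
have mf : measurable_fun setT (fun x : R => x ^+ 2) by exact: measurable_funX.
have := ge0_integral_independent mX mY XY mf mg (fun x => sqr_ge0 x)
  g0.
have -> : (\int[P]_w (g (Y w))%:E = P [set w | (`|Y w| <= M%:R)%R])%E.
  transitivity (\int[P]_w (\1_[set w | (`|Y w| <= M%:R)%R] w)%:E)%E; last first.
    by rewrite integral_indic// setIT.
  by apply: eq_integral => w _; rewrite /g !indicE; congr (_%:R%:E);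
    apply/idP/idP; rewrite !inE.
move=> E; apply/integrableP; split.
  by apply/measurable_EFinP; exact: measurable_funX.
under eq_integral do rewrite /= ger0_norm ?sqr_ge0//.
have : ((\int[P]_w (X w ^+ 2)%:E) * P [set w | (`|Y w| <= M%:R)%R] < +oo)%E.
  rewrite -E.
  have iM := finite_measure_integrable_cst P (2 * M%:R ^+ 2) measurableT.
  have iB := integrableD measurableT (integrableZl measurableT 2 iXY) iM.
  apply: le_lt_trans (integrable_lty measurableT iB).
  apply: ge0_le_integral => //.
  - by move=> w _; rewrite lee_fin mulr_ge0 ?sqr_ge0.
  - apply/measurable_EFinP; apply: measurable_funM; first exact: measurable_funX.
    exact: (measurableT_comp mg).
  - exact: measurable_int iB.
  - move=> w _; rewrite /= -EFinM -EFinD lee_fin /g indicE.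
    case: (boolP (Y w \in _)) => [|_]; last first.
      by rewrite mulr0; have := sqr_ge0 (X w + Y w); have := sqr_ge0 (M%:R : R); lra.
    rewrite inE /= mulr1 => YM.
    have Y2 : Y w ^+ 2 <= M%:R ^+ 2.
      by rewrite -[Y w ^+ 2]real_normK ?num_real// lerXn2r ?nnegrE.
    (* When [Y^2 <= M^2], the difference [2 (X + Y)^2 + 2 M^2 - X^2] is at least [(X + 2 Y)^2]. *)
    have := sqr_ge0 (X w + 2 * Y w); nra.
have : (0 <= \int[P]_w (X w ^+ 2)%:E)%E.
  by apply: integral_ge0 => w _; rewrite lee_fin sqr_ge0.
case: (\int[P]_w (X w ^+ 2)%:E)%E => [r||]//; first by rewrite ltry.
by rewrite gt0_mulye.
Qed.

End SquareIntegrable.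

Section SameLaw.
Context (R : realType) (d : measure_display) (T : measurableType d).
Context (P : probability T R) (X Y : T -> R).
Hypotheses (mX : measurable_fun setT X) (mY : measurable_fun setT Y).
Hypothesis XY : forall A : set R, measurable A -> P (X @^-1` A) = P (Y @^-1` A).

Lemma square_integrable_same_law : square_integrable P X -> square_integrable P Y.
Proof.
move=> [_ iX]; split => //.
have msq : measurable_fun setT (fun x : R => (x ^+ 2)%:E).
  by apply/measurable_EFinP; exact: measurable_funX.
apply/integrableP; split; first exact: (measurableT_comp msq).
move/integrableP: iX => [_].
under eq_integral do rewrite /= ger0_norm ?sqr_ge0//.
under [in X in _ -> X]eq_integral do rewrite /= ger0_norm ?sqr_ge0//.
pose X' : {RV P >-> R} := mfun_Sub (mem_set mX).
pose Y' : {RV P >-> R} := mfun_Sub (mem_set mY).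
have sq0 (y : R) : (0 <= (y ^+ 2)%:E :> \bar R)%E by rewrite lee_fin sqr_ge0.
have := ge0_integral_distribution X' msq sq0.
rewrite (eq_measure_integral (distribution P Y')); last by move=> A mA _; exact: XY.
by rewrite (ge0_integral_distribution Y' msq sq0) => <-.
Qed.

Lemma Rintegral_same_law (f : R -> R) : measurable_fun setT f ->
  P.-integrable setT (EFin \o (f \o X)) -> P.-integrable setT (EFin \o (f \o Y)) ->
  \int[P]_w f (X w) = \int[P]_w f (Y w).
Proof.
move=> mf ifX ifY.
pose X' : {RV P >-> R} := mfun_Sub (mem_set mX).
pose Y' : {RV P >-> R} := mfun_Sub (mem_set mY).
have mfE : measurable_fun setT (EFin \o f) by exact/measurable_EFinP.
have := integral_distribution (X := X') mfE ifX.
rewrite (eq_measure_integral (distribution P Y')); last by move=> A mA _; exact: XY.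
by rewrite (integral_distribution (X := Y') mfE ifY) /Rintegral /= => ->.
Qed.

End SameLaw.

(** * Mean, variance and covariance of the Lévy process *)

Lemma additive_natM (R : realType) (f : R -> R) (n : nat) (t : R) :
  (forall s t, 0 <= s -> 0 <= t -> f (s + t) = f s + f t) ->
  0 <= t -> f (n%:R * t) = n%:R * f t.
Proof.
move=> fD t0; elim: n => [|n IH].
  have := fD 0 0 (lexx _) (lexx _); rewrite addr0 !mul0r.
  by move/eqP; rewrite -subr_eq subrr eq_sym => /eqP.
by rewrite -natr1 !mulrDl !mul1r fD ?mulr_ge0// IH.
Qed.

(** Vanishing at [p] makes [f] periodic, so the bound [C] spreads to all nonnegative times; but
    [f (n t) = n f t] exceeds any bound unless [f t = 0]. *)
Lemma additive_periodic_eq0 (R : realType) (f : R -> R) (p C : R) :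
  0 < p -> (forall s t, 0 <= s -> 0 <= t -> f (s + t) = f s + f t) ->
  f p = 0 -> (forall t, 0 <= t <= p -> `|f t| <= C) ->
  forall t, 0 <= t -> f t = 0.
Proof.
move=> p0 fD fp fC.
have fb t : 0 <= t -> `|f t| <= C.
  move=> t0; pose n := Num.truncn (t / p).
  have tp0 : 0 <= t / p by rewrite divr_ge0// ltW.
  have /andP[h1 h2] : n%:R <= t / p < n.+1%:R by exact: truncn_itv.
  have r0 : 0 <= t - n%:R * p by rewrite subr_ge0 -ler_pdivlMr.
  have -> : t = n%:R * p + (t - n%:R * p) by ring.
  rewrite fD ?mulr_ge0 ?(ltW p0)// additive_natM ?(ltW p0)// fp mulr0 add0r.
  apply: fC; rewrite r0 /=.
  by move: h2; rewrite ltr_pdivrMr// -natr1; lra.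
move=> t t0; apply/eqP; apply: contraT => ft0.
have ft : 0 < `|f t| by rewrite normr_gt0.
have C0 : 0 <= C by apply: le_trans (fb 0 (lexx _)); exact: normr_ge0.
pose n := Num.bound (C / `|f t|).
have := fb (n%:R * t); rewrite mulr_ge0// => /(_ isT).
rewrite additive_natM// normrM ger0_norm// leNgt -ltr_pdivrMr//.
by rewrite archi_boundP// divr_ge0// ltW.
Qed.

Section LevyMoments.
Context (R : realType) (d : measure_display) (T : measurableType d).
Context (P : probability T R) (L : R -> T -> R).
Hypothesis levyL : levy_process P L.

Let D (s t : R) (w : T) : R := L t w - L s w.

Let mL t : measurable_fun setT (L t).
Proof. by case: levyL. Qed.

Let mD s t : measurable_fun setT (D s t).
Proof. exact: measurable_funB. Qed.

Lemma levy_independent (s t : R) : 0 <= s -> s <= t ->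
  independent P (D 0 s) (D s t).
Proof.
move=> s0 st A B mA mB.
case: levyL => _ [_ + _ _ _].
pose tt (i : nat) : R := if i is i'.+1 then (if i' is 0%N then s else t) else 0.
pose BB (i : nat) : set R := if i is 0%N then A else B.
move=> /(_ 2%N tt BB (lexx 0)) h.
have := h _ _.
rewrite !big_ord_recl big_ord0 /= mule1 => <-.
- congr (P _); apply/seteqP; split => w /=.
  + by move=> [wA wB] [|[|[]]].
  + by move=> hw; split; [exact: (hw 0%N)|exact: (hw 1%N)].
- by move=> [|[|[]]].
- by move=> [|i].
Qed.

Lemma levy_same_law (s t : R) (A : set R) : 0 <= s -> 0 <= t -> measurable A ->
  P (D 0 t @^-1` A) = P (D s (s + t) @^-1` A).
Proof. by move=> s0 t0 mA; case: levyL => _ [_ _ + _ _] => /(_ s t A s0 t0 mA) ->. Qed.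

Hypothesis L1 : P.-integrable setT (fun w => (L 1 w ^+ 2)%:E).
Hypothesis EL1 : ('E_P[L 1%R] = 0)%E.

(** The process starts at 0 only almost surely, so the assumptions on [L 1] are transferred to the
    increment from time 0 through an a.e. equality. *)
Let D01 : square_integrable P (D 0 1).
Proof.
split => //; apply/integrableP; split.
  by apply/measurable_EFinP; exact: measurable_funX.
move/integrableP: L1 => [mL1].
rewrite (ae_eq_integral (fun w => `|(D 0 1 w ^+ 2)%:E|%E))//.
- exact: measurableT_comp.
- apply: measurableT_comp => //.
  by apply/measurable_EFinP; exact: measurable_funX.
- case: levyL => _ [L0 _ _ _ _].
  by apply: filterS L0 => w L0w _; rewrite /D L0w subr0.
Qed.

Let ED01 : \int[P]_w D 0 1 w = 0.
Proof.
rewrite /Rintegral; have -> : (\int[P]_w (D 0 1 w)%:E = 'E_P[L 1%R])%E.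
  rewrite unlock; apply: ae_eq_integral => //.
  - exact/measurable_EFinP.
  - exact/measurable_EFinP.
  - case: levyL => _ [L0 _ _ _ _].
    by apply: filterS L0 => w L0w _; rewrite /D /= L0w subr0.
by rewrite EL1.
Qed.

Let DE (s t : R) : D 0 (s + t) = (fun w => D 0 s w + D s (s + t) w).
Proof. by apply/funext => w; rewrite /D; ring. Qed.

(** Integer times follow by adding copies of the unit increment. A real [t] lies below an integer,
    and [D 0 t] is then an independent summand of a square-integrable variable. *)
Lemma levy_square_integrable (t : R) : 0 <= t -> square_integrable P (D 0 t).
Proof.
move=> t0.
have hn (n : nat) : square_integrable P (D 0 n.+1%:R).
  elim: n => [//|n IH].
  rewrite -natr1 DE; apply: square_integrableD => //.
  by apply: square_integrable_same_law D01 => // A mA; exact: levy_same_law.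
have tn : t <= (Num.bound t).+1%:R.
  by apply: le_trans (ltW (archi_boundP t0)) _; rewrite ler_nat.
apply: (@square_integrable_independentD _ _ _ _ _ (D t (Num.bound t).+1%:R)) => //.
  exact: levy_independent.
have := hn (Num.bound t).
by rewrite -{1}[_.+1%:R](subrKC t) DE subrKC.
Qed.

Let sD (s t : R) : 0 <= s -> 0 <= t -> square_integrable P (D s (s + t)).
Proof.
move=> s0 t0; have := levy_square_integrable t0.
by apply: square_integrable_same_law => // A mA; exact: levy_same_law.
Qed.

(** Mean, second moment and variance. The mean is known to vanish only at time 1 so far; the
    variance is additive whatever the mean, and its linearity is used to show that the mean
    vanishes. *)
Let m t := \int[P]_w D 0 t w.
Let q t := \int[P]_w (D 0 t w) ^+ 2.
Let v t := q t - m t ^+ 2.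

Let mDE s t : 0 <= s -> 0 <= t -> \int[P]_w D s (s + t) w = m t.
Proof.
move=> s0 t0; rewrite /m.
apply: (@Rintegral_same_law _ _ _ _ _ _ _ _ _ id) => //.
- by move=> A mA; rewrite [RHS](levy_same_law s0 t0).
- exact/square_integrable_integrable/sD.
- exact/square_integrable_integrable/levy_square_integrable.
Qed.

Let qDE s t : 0 <= s -> 0 <= t -> \int[P]_w (D s (s + t) w) ^+ 2 = q t.
Proof.
move=> s0 t0; rewrite /q.
apply: (@Rintegral_same_law _ _ _ _ _ _ _ _ _ (fun x => x ^+ 2)) => //.
- by move=> A mA; rewrite [RHS](levy_same_law s0 t0).
- by case: (sD s0 t0).
- by case: (levy_square_integrable t0).
Qed.

Let m_add s t : 0 <= s -> 0 <= t -> m (s + t) = m s + m t.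
Proof.
move=> s0 t0; rewrite -(mDE s0 t0) {1}/m DE RintegralD//.
- exact/square_integrable_integrable/levy_square_integrable.
- exact/square_integrable_integrable/sD.
Qed.

Let cross s t : 0 <= s -> 0 <= t ->
  \int[P]_w (D 0 s w * D s (s + t) w) = m s * m t.
Proof.
move=> s0 t0; rewrite -(mDE s0 t0); apply: Rintegral_independent_mul.
- exact: levy_square_integrable.
- exact: sD.
- by apply: levy_independent => //; rewrite lerDl.
Qed.

Let q_add s t : 0 <= s -> 0 <= t -> q (s + t) = q s + q t + 2 * (m s * m t).
Proof.
move=> s0 t0; have [_ ints] := levy_square_integrable s0.
have [_ intt] := sD s0 t0.
have ist := square_integrable_mul (levy_square_integrable s0) (sD s0 t0).
rewrite -(cross s0 t0) -(qDE s0 t0) {1}/q DE -RintegralZl// -RintegralD//.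
rewrite -RintegralD//.
- by apply: eq_Rintegral => w _; ring.
- exact: eq_integrable (integrableD measurableT ints intt).
- exact: eq_integrable (integrableZl measurableT 2 ist).
Qed.

Let v_add s t : 0 <= s -> 0 <= t -> v (s + t) = v s + v t.
Proof. by move=> s0 t0; rewrite /v q_add// m_add//; ring. Qed.

Let vE t : 0 <= t -> v t = \int[P]_w (D 0 t w - m t) ^+ 2.
Proof.
move=> t0; have ht := levy_square_integrable t0; have [_ iq] := ht.
have i1 := square_integrable_integrable ht.
have ic := finite_measure_integrable_cst P (m t ^+ 2) measurableT.
have iZ : P.-integrable setT (EFin \o (fun w => 2 * m t * D 0 t w)).
  exact: eq_integrable (integrableZl measurableT (2 * m t) i1).
transitivity (\int[P]_w ((D 0 t w ^+ 2 - 2 * m t * D 0 t w) + m t ^+ 2)); last first.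
  by apply: eq_Rintegral => w _; ring.
rewrite RintegralD//; last first.
  exact: eq_integrable (integrableB measurableT iq iZ).
rewrite RintegralB// RintegralZl// Rintegral_cstP -/(m t) -/(q t) /v; ring.
Qed.

Let v_ge0 t : 0 <= t -> 0 <= v t.
Proof. by move=> t0; rewrite vE//; apply: Rintegral_ge0 => w _; exact: sqr_ge0. Qed.

(** On [[0, 1]], [v u + v (1 - u) = v 1] with nonnegative terms keeps [v u] between 0 and [v 1];
    this bounds the additive function [v t - t * v 1], which vanishes at 1. *)
Let v_linear t : 0 <= t -> v t = t * v 1.
Proof.
move=> t0; apply/eqP; rewrite -subr_eq0; apply/eqP.
pose f t := v t - t * v 1.
apply: (@additive_periodic_eq0 _ f 1 (v 1)) => //.
- by move=> s u s0 u0; rewrite /f v_add//; ring.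
- by rewrite /f mul1r subrr.
- move=> u /andP[u0 u1].
  have := v_add u0 (_ : 0 <= 1 - u); rewrite subr_ge0 subrKC => /(_ u1) vu.
  have := v_ge0 (_ : 0 <= 1 - u); rewrite subr_ge0 => /(_ u1) vu1.
  have := v_ge0 u0; have := v_ge0 (@ler01 R) => v10 vu0.
  by rewrite /f ler_norml; apply/andP; split; nra.
Qed.

(** Stochastic continuity gives [|D 0 t| < 1/2] with probability above 1/2 for small [t]. If
    [|m t| > 1], the distance to the mean would then be at least 1/2 on that event, forcing a
    variance above [1/4 * 1/2 = 1/8]. *)
Let m_near0 : exists2 e : R, 0 < e &
  forall t, 0 <= t -> t < e -> t * v 1 < 1/8 -> `|m t| <= 1.
Proof.
case: levyL => _ [_ _ _ + _].
move=> /(_ 0 (1/2) (lexx 0) (_ : 0 < 1/2))/=.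
have h12 : (0 : R) < 1/2 by lra.
move=> /(_ h12) cv.
have nb : nbhs (0%E : \bar R) [set y | (y < (1/2)%:E)%E].
  apply: open_nbhs_nbhs; split; first exact: open_ereal_lt_ereal.
  by rewrite /= lte_fin.
have := cv _ nb; rewrite /= /within /= => /nbhs_ballP[e e0 he].
exists e => // t t0 te tv; rewrite leNgt; apply/negP => m1.
have := he t; rewrite /ball /= sub0r normrN ger0_norm// => /(_ te t0).
set A := [set w | _] => PA.
have mA : measurable A.
  have := @measurable_fun_ler _ T R setT (cst (1/2)) (Num.norm \o D 0 t).
  move=> /(_ (measurable_cst _) (measurableT_comp (@normr_measurable R setT) (mD 0 t))).
  by move=> /(_ measurableT [set true] I); rewrite setTI.
have mCA := measurableC mA.
have i1 : P.-integrable setT (EFin \o (fun w => 4^-1 * \1_(~` A) w)).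
  apply: (le_integrable measurableT _ _
    (finite_measure_integrable_cst P 1 measurableT)).
    by apply/measurable_EFinP; apply: measurable_funM => //; exact: measurable_indic.
  move=> w _; rewrite /= lee_fin indicE.
  by case: (_ \in _); rewrite ?mulr1 ?mulr0 ?normr0 ?normr1// ger0_norm; lra.
have i2 : P.-integrable setT (EFin \o (fun w => (D 0 t w - m t) ^+ 2)).
  by case: (square_integrableB (levy_square_integrable t0) (square_integrable_cst P (m t))).
have : \int[P]_w (4^-1 * \1_(~` A) w) <= v t.
  rewrite vE//; apply: le_Rintegral => // w _; rewrite indicE.
  case: (boolP (w \in _)) => [|_]; last by rewrite mulr0 sqr_ge0.
  rewrite inE /A /= mulr1 => /negP; rewrite -ltNge => Dw.
  have h : 1/2 <= `|D 0 t w - m t|.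
    have := ler_normB (D 0 t w) (D 0 t w - m t); rewrite subKr.
    by move: Dw m1; rewrite /D; lra.
  rewrite -real_normK ?num_real//; nra.
rewrite v_linear// RintegralZl//; last first.
  apply: (le_integrable measurableT _ _
    (finite_measure_integrable_cst P 1 measurableT)).
    by apply/measurable_EFinP; exact: measurable_indic.
  move=> w _; rewrite /= lee_fin indicE.
  by case: (_ \in _); rewrite ?normr0 ?normr1//.
have PAf : P A \is a fin_num by exact: fin_num_measure.
have PC : fine (P (~` A)) = 1 - fine (P A) by rewrite probability_setC// fineB.
rewrite /Rintegral integral_indic// setIT => hv.
have : 4^-1 * (1 - fine (P A)) <= t * v 1 by rewrite -PC; exact: hv.
by move: PA; rewrite -[P A]fineK// lte_fin /=; lra.
Qed.

Let m_eq0 t : 0 <= t -> m t = 0.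
Proof.
have [e e0 he] := m_near0.
have v10 : 0 <= v 1 by exact: v_ge0.
(* The two summands ensure [1/N < e] and [v 1 / N < 1/8], so the mean is bounded on [[0, 1/N]]; it
   vanishes at [1/N] because [N * m (1/N) = m 1 = 0]. *)
pose N := (Num.bound (e^-1 + 8 * v 1)).+1.
have NR : e^-1 + 8 * v 1 < N%:R.
  apply: lt_trans (archi_boundP _) _; last by rewrite ltr_nat.
  by rewrite addr_ge0 ?mulr_ge0 ?invr_ge0 ?(ltW e0).
have N0 : (0 : R) < N%:R by rewrite ltr0n.
have mN : m N%:R^-1 = 0.
  have := @additive_natM _ m N N%:R^-1 m_add; rewrite invr_ge0 (ltW N0) => /(_ isT).
  rewrite mulfV ?gt_eqF// {1}/m ED01 => /esym/eqP.
  by rewrite mulf_eq0 gt_eqF//= => /eqP.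
apply: (@additive_periodic_eq0 _ m N%:R^-1 1) => //; first by rewrite invr_gt0.
move=> u /andP[u0 uN]; apply: he => //.
  apply: le_lt_trans uN _; rewrite -[ltRHS]invrK ltf_pV2 ?posrE ?invr_gt0//.
  by apply: le_lt_trans NR; rewrite lerDl mulr_ge0.
apply: (@le_lt_trans _ _ (N%:R^-1 * v 1)); first by rewrite ler_wpM2r.
rewrite mulrC ltr_pdivrMr//; have : 0 < e^-1 by rewrite invr_gt0.
lra.
Qed.

(** For [s <= t], the later increment is the earlier one plus an independent centred one, so only
    the variance [s * v 1] survives; hence [c = v 1]. *)
Lemma levy_covariance : exists2 c : R, 0 <= c & forall s t, 0 <= s -> 0 <= t ->
  \int[P]_w ((L s w - L 0 w) * (L t w - L 0 w)) = c * Num.min s t.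
Proof.
exists (v 1); first exact: v_ge0.
have h s t : 0 <= s -> s <= t -> \int[P]_w (D 0 s w * D 0 t w) = v 1 * s.
  move=> s0 st.
  have ts0 : 0 <= t - s by rewrite subr_ge0.
  have hc := cross s0 ts0; rewrite subrKC m_eq0// mul0r in hc.
  have hs := levy_square_integrable s0.
  have hst := sD s0 ts0; rewrite subrKC in hst.
  transitivity (\int[P]_w (D 0 s w ^+ 2 + D 0 s w * D s t w)).
    by apply: eq_Rintegral => w _; rewrite /D; ring.
  rewrite RintegralD//; last 2 first.
  - by case: hs.
  - exact: square_integrable_mul.
  rewrite hc addr0 mulrC -v_linear// /v m_eq0// expr0n subr0//.
move=> s t s0 t0; have [st|ts] := leP s t; first exact: h.
rewrite -(h _ _ t0 (ltW ts)); apply: eq_Rintegral => w _; exact: mulrC.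
Qed.

End LevyMoments.

(** * The isometry for step functions *)

Section QuadraticForm.
Context (R : realType) (d : measure_display) (T : measurableType d).
Context (mu : {measure set T -> \bar R}).

Lemma integrable_sumR (I : Type) (r : seq I) (F : I -> T -> R) :
  (forall i, mu.-integrable setT (EFin \o F i)) ->
  mu.-integrable setT (EFin \o (fun w => \sum_(i <- r) F i w)).
Proof.
move=> hF; elim: r => [|i r IH].
  apply: eq_integrable (integrable0 mu setT) => // w _.
  by rewrite /= big_nil.
apply: eq_integrable (integrableD measurableT (hF i) IH) => // w _.
by rewrite /= big_cons EFinD.
Qed.

Lemma Rintegral_sum (I : Type) (r : seq I) (F : I -> T -> R) :
  (forall i, mu.-integrable setT (EFin \o F i)) ->
  \int[mu]_w (\sum_(i <- r) F i w) = \sum_(i <- r) \int[mu]_w F i w.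
Proof.
move=> hF; elim: r => [|i r IH].
  rewrite big_nil -[RHS](Rintegral_set0 mu (fun=> 0)).
  rewrite /Rintegral integral_set0 integral0_eq// => w _.
  by rewrite big_nil.
rewrite big_cons -IH -RintegralD//; last exact: integrable_sumR.
by apply: eq_Rintegral => w _; rewrite big_cons.
Qed.

Definition lincomb (F : R -> T -> R) (r : seq (R * R)) (w : T) : R :=
  \sum_(i <- r) i.1 * F i.2 w.

Context (F : R -> T -> R) (K : R -> R -> R).
Hypothesis iF : forall x y, mu.-integrable setT (EFin \o (fun w => F x w * F y w)).
Hypothesis KF : forall x y, \int[mu]_w (F x w * F y w) = K x y.

Let lincomb_sqrE r w : lincomb F r w ^+ 2 =
  \sum_(i <- r) \sum_(j <- r) i.1 * j.1 * (F i.2 w * F j.2 w).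
Proof.
rewrite expr2 big_distrlr/=; apply: eq_bigr => i _; apply: eq_bigr => j _; ring.
Qed.

Let iterm (c x y : R) : mu.-integrable setT (EFin \o (fun w => c * (F x w * F y w))).
Proof. exact: eq_integrable (integrableZl measurableT c (iF x y)). Qed.

Lemma integrable_lincomb_sqr r :
  mu.-integrable setT (EFin \o (fun w => lincomb F r w ^+ 2)).
Proof.
rewrite (_ : (fun w => _) = fun w =>
    \sum_(i <- r) \sum_(j <- r) i.1 * j.1 * (F i.2 w * F j.2 w)).
  by apply: integrable_sumR => i; exact: integrable_sumR.
by apply/funext => w; exact: lincomb_sqrE.
Qed.

(** Used on the probability space and on the line with the same coefficient list [r], it reduces the
    isometry to a comparison of the two Gram kernels [K]. *)
Lemma Rintegral_lincomb_sqr r : \int[mu]_w lincomb F r w ^+ 2 =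
  \sum_(i <- r) \sum_(j <- r) i.1 * j.1 * K i.2 j.2.
Proof.
under eq_Rintegral do rewrite lincomb_sqrE.
rewrite Rintegral_sum; last by move=> i; exact: integrable_sumR.
apply: eq_bigr => i _; rewrite Rintegral_sum//; apply: eq_bigr => j _.
by rewrite RintegralZl// KF.
Qed.

End QuadraticForm.

(** The absolute value makes every real a legitimate index, so lists of coefficients carry no sign
    condition. The Gram kernel is [min |x| |y|]. *)
Definition initial_indic (R : realType) (x v : R) : R :=
  if (0 < v) && (v <= `|x|) then 1 else 0.

Lemma initial_indicE (R : realType) (x : R) :
  initial_indic x = \1_(`]0, `|x|]%classic : set R).
Proof.
apply/funext => v; rewrite /initial_indic indicE.
case: ifPn => h; first by rewrite mem_set//= in_itv.
by rewrite memNset//= in_itv; exact/negP.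
Qed.

Lemma measurable_initial_indic (R : realType) (x : R) :
  measurable_fun setT (initial_indic x).
Proof. by rewrite initial_indicE; exact: measurable_indic. Qed.

Lemma initial_indicM (R : realType) (x y v : R) :
  initial_indic x v * initial_indic y v = initial_indic (Num.min `|x| `|y|) v.
Proof.
have m0 : 0 <= Num.min `|x| `|y| by rewrite le_min !normr_ge0.
rewrite /initial_indic (ger0_norm m0) le_min.
by case: (0 < v) => /=; rewrite ?mulr0//; case: (v <= `|x|) => /=;
  rewrite ?mul1r ?mul0r.
Qed.

Lemma integral_initial_indic (R : realType) (x : R) :
  (\int[@lebesgue_measure R]_v (initial_indic x v)%:E = `|x|%:E)%E.
Proof.
rewrite initial_indicE integral_indic//= setIT lebesgue_measure_itv/= lte_fin.
case: ifPn => [_|]; first by rewrite sube0.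
by rewrite -leNgt => h; congr EFin; apply/eqP; rewrite eq_le h normr_ge0.
Qed.

Section Isometry.
Context (R : realType) (d : measure_display) (T : measurableType d).
Context (P : probability T R) (L : R -> T -> R) (c : R).
Hypothesis sL : forall t, 0 <= t -> square_integrable P (fun w => L t w - L 0 w).
Hypothesis covL : forall s t, 0 <= s -> 0 <= t ->
  \int[P]_w ((L s w - L 0 w) * (L t w - L 0 w)) = c * Num.min s t.

Let X (x : R) (w : T) := L `|x| w - L 0 w.

(* Formal combinations [r] of initial segments tie a step function to its
   integral without a common refinement of partitions. *)
Definition step_pair (phi : R -> R) (Z : T -> R) : Prop := exists r : seq (R * R),
  phi = lincomb (@initial_indic R) r /\ Z = lincomb X r.

Lemma step_pairD phi Z psi W : step_pair phi Z -> step_pair psi W ->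
  step_pair (fun v => phi v + psi v) (fun w => Z w + W w).
Proof.
move=> [r [-> ->]] [q [-> ->]]; exists (r ++ q).
by split; apply/funext => w; rewrite /lincomb big_cat.
Qed.

Lemma step_pairZ a phi Z : step_pair phi Z ->
  step_pair (fun v => a * phi v) (fun w => a * Z w).
Proof.
move=> [r [-> ->]]; exists [seq (a * i.1, i.2) | i <- r].
by split; apply/funext => w; rewrite /lincomb big_map mulr_sumr;
  apply: eq_bigr => i _; rewrite mulrA.
Qed.

Lemma step_pairB phi Z psi W : step_pair phi Z -> step_pair psi W ->
  step_pair (fun v => phi v - psi v) (fun w => Z w - W w).
Proof.
move=> h1 h2; have := step_pairD h1 (step_pairZ (-1) h2).
by under eq_fun do rewrite mulN1r; under [X in step_pair _ X]eq_fun do rewrite mulN1r.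
Qed.

Lemma step_pair0 : step_pair (fun=> 0) (fun=> 0).
Proof. by exists [::]; split; apply/funext => w; rewrite /lincomb big_nil. Qed.

Lemma step_pair_initial x : 0 <= x ->
  step_pair (initial_indic x) (fun w => L x w - L 0 w).
Proof.
move=> x0; exists [:: (1, x)].
by split; apply/funext => w; rewrite /lincomb big_seq1 mul1r// /X ger0_norm.
Qed.

(** The indicator of []p i, p (i+1)]] is a difference of two initial segments, and the increment of
    [L] is the same difference of values of [L - L 0]. *)
Lemma step_pair_step t n p a : is_partition t n p ->
  step_pair (step_fun n p a) (step_int L n p a).
Proof.
move=> [p0 [_ pinc]].
have pge0 i : (i <= n)%N -> 0 <= p i.
  elim: i => [|i IH] ilt; first by rewrite p0.
  by apply: le_trans (ltW (pinc i ilt)); exact/IH/ltnW.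
have hm m : (m <= n)%N -> step_pair (step_fun m p a) (step_int L m p a).
  elim: m => [|m IH] mn.
    have := step_pair0; rewrite (_ : step_fun 0 p a = fun=> 0); last first.
      by apply/funext => v; rewrite /step_fun big_ord0.
    by rewrite (_ : step_int L 0 p a = fun=> 0)//; apply/funext => w;
      rewrite /step_int big_ord0.
  have p1 := pge0 _ mn; have pm := pge0 _ (ltnW mn).
  have := step_pairD (IH (ltnW mn)) (step_pairZ (a m)
    (step_pairB (step_pair_initial p1) (step_pair_initial pm))).
  rewrite (_ : step_fun m.+1 p a = fun v => step_fun m p a v +
      a m * (initial_indic (p m.+1) v - initial_indic (p m) v)); last first.
    apply/funext => v; rewrite /step_fun big_ord_recr /=; congr (_ + _).
    rewrite /initial_indic !ger0_norm//.
    have pp := pinc m mn.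
    case: (ltP (p m) v) => h1 /=.
      rewrite (le_lt_trans pm h1)/= subr0.
      by case: ifP; rewrite ?mulr1 ?mulr0.
    rewrite (le_trans h1 (ltW pp)).
    by case: (0 < v); rewrite /= ?subrr mulr0.
  rewrite (_ : step_int L m.+1 p a = fun w => step_int L m p a w +
      a m * ((L (p m.+1) w - L 0 w) - (L (p m) w - L 0 w)))//.
  apply/funext => w; rewrite /step_int big_ord_recr /=; congr (_ + _); ring.
exact: hm.
Qed.

Lemma step_pair_measurable phi Z : step_pair phi Z ->
  measurable_fun setT phi /\ measurable_fun setT Z.
Proof.
move=> [r [-> ->]]; split; apply: measurable_sum => i; apply: measurable_funM => //.
  exact: measurable_initial_indic.
by case: (sL (normr_ge0 i.2)).
Qed.

(** The Gram kernels are [c * min |x| |y|] for the process and [min |x| |y|] for the segments, so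
    the two quadratic forms differ by the factor [c]. *)
Lemma step_pair_isometry phi Z : step_pair phi Z ->
  (\int[P]_w (Z w ^+ 2)%:E =
   c%:E * \int[@lebesgue_measure R]_v (phi v ^+ 2)%:E)%E.
Proof.
move=> [r [-> ->]].
have iX x y : P.-integrable setT (EFin \o (fun w => X x w * X y w)).
  by apply: square_integrable_mul; apply: sL.
have iI x y : (@lebesgue_measure R).-integrable setT
    (EFin \o (fun v => initial_indic x v * initial_indic y v)).
  rewrite (_ : (fun v => _) = initial_indic (Num.min `|x| `|y|)); last first.
    by apply/funext => v; rewrite initial_indicM.
  apply/integrableP; split.
    by apply/measurable_EFinP; exact: measurable_initial_indic.
  under eq_integral do rewrite /= ger0_norm ?initial_indicE//.
  by rewrite -initial_indicE integral_initial_indic ltry.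
have fP := integrable_fin_num measurableT (integrable_lincomb_sqr iX r).
have fI := integrable_fin_num measurableT (integrable_lincomb_sqr iI r).
rewrite -(fineK fP) -(fineK fI) -EFinM; congr EFin.
have := @Rintegral_lincomb_sqr _ _ _ P X (fun x y => c * Num.min `|x| `|y|) iX.
rewrite /Rintegral => -> //; last by move=> x y; exact: covL.
have := @Rintegral_lincomb_sqr _ _ _ (@lebesgue_measure R) (@initial_indic R)
  (fun x y => Num.min `|x| `|y|) iI.
rewrite /Rintegral => -> //; last first.
  move=> x y; under eq_integral do rewrite initial_indicM.
  by rewrite integral_initial_indic /= ger0_norm// le_min !normr_ge0.
rewrite mulr_sumr; apply: eq_bigr => i _; rewrite mulr_sumr; apply: eq_bigr => j _.
by rewrite mulrCA.
Qed.

End Isometry.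

(** * From step functions to increments of the integral process *)

Lemma integral_sqr3_le (R : realType) (d : measure_display) (T : measurableType d)
    (mu : {measure set T -> \bar R}) (e f g h : T -> R) :
  measurable_fun setT f -> measurable_fun setT g -> measurable_fun setT h ->
  (forall w, e w = f w + g w + h w) ->
  (\int[mu]_w (e w ^+ 2)%:E <=
   3%:E * (\int[mu]_w (f w ^+ 2)%:E + \int[mu]_w (g w ^+ 2)%:E +
     \int[mu]_w (h w ^+ 2)%:E))%E.
Proof.
move=> mf mg mh eE.
have m2 (k : T -> R) : measurable_fun setT k ->
    measurable_fun setT (fun w => (k w ^+ 2)%:E).
  by move=> mk; apply/measurable_EFinP; exact: measurable_funX.
have k0 (k : T -> R) w : (0 <= (k w ^+ 2)%:E :> \bar R)%E by rewrite lee_fin sqr_ge0.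
rewrite -ge0_integralD//; [|exact: m2|exact: m2].
rewrite -ge0_integralD//; last 3 first.
- by move=> w _; rewrite adde_ge0.
- by apply: emeasurable_funD; exact: m2.
- exact: m2.
rewrite -ge0_integralZl//; last 2 first.
- by apply: emeasurable_funD; [apply: emeasurable_funD|]; exact: m2.
- by move=> w _; rewrite !adde_ge0.
apply: ge0_le_integral => //.
- rewrite (_ : e = fun w => f w + g w + h w); last exact/funext.
  by apply: m2; apply: measurable_funD => //; exact: measurable_funD.
- apply: emeasurable_funM => //.
  by apply: emeasurable_funD; [apply: emeasurable_funD|]; exact: m2.
- move=> w _; rewrite -!EFinD -EFinM lee_fin eE.
  have := sqr_ge0 (f w - g w); have := sqr_ge0 (g w - h w).
  have := sqr_ge0 (f w - h w); nra.
Qed.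

Lemma step_fun_out (R : realType) (t : R) n p a v :
  is_partition t n p -> ~ (0 <= v <= t) -> step_fun n p a v = 0.
Proof.
move=> [p0 [pn pinc]] vt.
have mono i j : (i <= j)%N -> (j <= n)%N -> p i <= p j.
  move=> ij; elim: j ij => [|j IH]; first by rewrite leqn0 => /eqP ->.
  rewrite leq_eqVlt => /predU1P[-> //|]; rewrite ltnS => ij jn.
  by apply: le_trans (ltW (pinc j jn)); apply: IH => //; exact: ltnW.
rewrite /step_fun big1// => i _; case: ifPn => // /andP[h1 h2].
exfalso; apply: vt; rewrite -{1}p0 -{1}pn.
rewrite (le_trans (mono _ _ (leq0n i) (ltnW (ltn_ord i))) (ltW h1)).
by rewrite (le_trans h2 (mono _ _ (ltn_ord i) (leqnn n))).
Qed.

(** Both functions vanish outside [[0, t]]. Integrals over the whole line are what allows the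
    kernels at two different times to be compared. *)
Lemma integral_step_fun_zH (R : realType) (H t : R) n p a : is_partition t n p ->
  (\int[@lebesgue_measure R]_(s in `[0%R, t]) ((step_fun n p a s - zH H t s) ^+ 2)%:E =
   \int[@lebesgue_measure R]_s ((step_fun n p a s - zH H t s) ^+ 2)%:E)%E.
Proof.
move=> hp; rewrite integral_mkcond; apply: eq_integral => v _.
rewrite patchE; case: ifPn => //; rewrite notin_setE /= in_itv /= => vt.
rewrite (step_fun_out _ hp)// zH_out ?subrr ?expr0n//.
by apply: contraT; rewrite negb_or -!ltNge => /andP[v0 vt'];
  exfalso; apply: vt; rewrite !ltW.
Qed.

(** Passing to the limit leaves [3 * c * 3 * I]. Since the error limits are finite, the sums have a
    limit even if [I] is infinite, so no finiteness of the kernel distance is required. *)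
Lemma ereal_le_of_vanishing_errors (R : realType) (x I : \bar R) (c : R)
    (At As Bt Bs : nat -> \bar R) :
  At @ \oo --> (0 : \bar R)%E -> As @ \oo --> (0 : \bar R)%E ->
  Bt @ \oo --> (0 : \bar R)%E -> Bs @ \oo --> (0 : \bar R)%E ->
  (forall k, x <= 3%:E * (At k + c%:E * (3%:E * (Bt k + I + Bs k)) + As k))%E ->
  (x <= (9 * c)%:E * I)%E.
Proof.
move=> cAt cAs cBt cBs bound.
have cB : (Bt k + I + Bs k)%E @[k --> \oo] --> I.
  rewrite -[X in _ --> X]adde0 -[X in _ --> (X + _)%E]add0e.
  apply: cvgeD => //; first by rewrite fin_num_adde_defl.
  by apply: cvgeD => //; exact: cvg_cst.
have cU : (3%:E * (At k + c%:E * (3%:E * (Bt k + I + Bs k)) + As k))%E @[k --> \oo]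
    --> (3%:E * (c%:E * (3%:E * I)))%E.
  apply: cvgeZl => //.
  rewrite -[X in _ --> X]adde0 -[X in _ --> (X + _)%E]add0e.
  apply: cvgeD => //; first by rewrite fin_num_adde_defl.
  apply: cvgeD => //.
  by apply: cvgeZl => //; exact: cvgeZl.
have -> : ((9 * c)%:E * I = 3%:E * (c%:E * (3%:E * I)))%E.
  by rewrite !muleA -!EFinM; congr (_%:E * _)%E; ring.
rewrite -(cvg_lim _ cU)//; apply: lime_ge; first exact: cvgP cU.
exact: nearW.
Qed.

Section WienerIncrement.
Context (R : realType) (d : measure_display) (T : measurableType d).
Context (P : probability T R) (L : R -> T -> R) (c : R).
Hypothesis c0 : 0 <= c.
Hypothesis sL : forall t, 0 <= t -> square_integrable P (fun w => L t w - L 0 w).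
Hypothesis covL : forall s t, 0 <= s -> 0 <= t ->
  \int[P]_w ((L s w - L 0 w) * (L t w - L 0 w)) = c * Num.min s t.

(** [Yt - Ys] splits as [(Yt - Z) + (Z - W) + (W - Ys)]. The isometry turns the middle piece into
    [phi - psi], which splits in turn around [zH H t - zH H s]. *)
Lemma wiener_increment_le (H s t : R) (Ys Yt : T -> R) :
  measurable_fun setT Ys -> measurable_fun setT Yt ->
  wiener_integral P L (zH H s) s Ys -> wiener_integral P L (zH H t) t Yt ->
  (\int[P]_w ((Yt w - Ys w) ^+ 2)%:E <=
   (9 * c)%:E * \int[@lebesgue_measure R]_v ((zH H t v - zH H s v) ^+ 2)%:E)%E.
Proof.
move=> mYs mYt [ns [ps [as_ [hps [cs Cs]]]]] [nt [pt [at_ [hpt [ct Ct]]]]].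
pose I := (\int[@lebesgue_measure R]_v ((zH H t v - zH H s v) ^+ 2)%:E)%E.
pose phi k := step_fun (nt k) (pt k) (at_ k); pose psi k := step_fun (ns k) (ps k) (as_ k).
pose Z k := step_int L (nt k) (pt k) (at_ k); pose W k := step_int L (ns k) (ps k) (as_ k).
pose At k := (\int[P]_w ((Z k w - Yt w) ^+ 2)%:E)%E.
pose As k := (\int[P]_w ((W k w - Ys w) ^+ 2)%:E)%E.
pose Bt k := (\int[@lebesgue_measure R]_v ((phi k v - zH H t v) ^+ 2)%:E)%E.
pose Bs k := (\int[@lebesgue_measure R]_v ((psi k v - zH H s v) ^+ 2)%:E)%E.
have cAt : At @ \oo --> (0 : \bar R)%E by move: Ct; under eq_fun do rewrite unlock.
have cAs : As @ \oo --> (0 : \bar R)%E by move: Cs; under eq_fun do rewrite unlock.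
have cBt : Bt @ \oo --> (0 : \bar R)%E.
  by move: ct; under eq_fun => k do rewrite (integral_step_fun_zH _ _ (hpt k)).
have cBs : Bs @ \oo --> (0 : \bar R)%E.
  by move: cs; under eq_fun => k do rewrite (integral_step_fun_zH _ _ (hps k)).
have bound k : (\int[P]_w ((Yt w - Ys w) ^+ 2)%:E <=
    3%:E * (At k + c%:E * (3%:E * (Bt k + I + Bs k)) + As k))%E.
  have pt_ := step_pair_step L (at_ k) (hpt k).
  have ps_ := step_pair_step L (as_ k) (hps k).
  have [mphi mZ] := step_pair_measurable sL pt_.
  have [mpsi mW] := step_pair_measurable sL ps_.
  have mzt := measurable_zH H t; have mzs := measurable_zH H s.
  have iso := step_pair_isometry sL covL (step_pairB pt_ ps_).
  apply: (@le_trans _ _ (3%:E * (At k + \int[P]_w ((Z k w - W k w) ^+ 2)%:E + As k))%E).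
    have -> : At k = (\int[P]_w ((Yt w - Z k w) ^+ 2)%:E)%E.
      by apply: eq_integral => w _; rewrite -sqrrN opprB.
    apply: integral_sqr3_le; try exact: measurable_funB.
    by move=> w; ring.
  rewrite lee_pmul2l// leeD2r// leeD2l// iso lee_wpmul2l ?lee_fin//.
  have -> : Bs k = (\int[@lebesgue_measure R]_v ((zH H s v - psi k v) ^+ 2)%:E)%E.
    by apply: eq_integral => v _; rewrite -sqrrN opprB.
  apply: integral_sqr3_le; try exact: measurable_funB.
  by move=> v; rewrite /phi /psi; ring.
exact: (ereal_le_of_vanishing_errors cAt cAs cBt cBs bound).
Qed.

End WienerIncrement.

(** * Almost sure convergence along dyadic partitions *)

(** The sum of all [S n] has integral at most [K / (1 - q)], so it is finite almost everywhere, and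
    the terms of a convergent series tend to 0. *)
Lemma ae_cvg0_summable_integral (R : realType) (d : measure_display)
    (T : measurableType d) (mu : {measure set T -> \bar R}) (S : nat -> T -> R)
    (K q : R) :
  (forall n, measurable_fun setT (S n)) -> (forall n w, 0 <= S n w) ->
  0 <= K -> 0 < q < 1 ->
  (forall n, (\int[mu]_w (S n w)%:E <= (K * q ^+ n)%:E)%E) ->
  {ae mu, forall w, S n w @[n --> \oo] --> (0 : R)}.
Proof.
move=> mS S0 K0 /andP[q0 q1] IS.
have mSE n : measurable_fun setT (fun w => (S n w)%:E) by exact/measurable_EFinP.
have S0E n w : (0 <= (S n w)%:E :> \bar R)%E by rewrite lee_fin.
have sumE0 w : (0 <= \sum_(n <oo) (S n w)%:E)%E by exact: nneseries_ge0.
have int_fin : mu.-integrable setT (fun w => (\sum_(n <oo) (S n w)%:E)%E).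
  apply/integrableP; split; first exact: ge0_emeasurable_sum.
  under eq_integral do rewrite gee0_abs//.
  rewrite integral_nneseries//.
  apply: (@le_lt_trans _ _ (K / (1 - q))%:E); last by rewrite ltry.
  apply: lime_le; first by apply: is_cvg_nneseries => n _ _; exact: integral_ge0.
  apply: nearW => n.
  apply: (@le_trans _ _ (\sum_(0 <= i < n) (K * q ^+ i)%:E)%E).
    by apply: lee_sum => i _; exact: IS.
  rewrite sumEFin lee_fin; apply: geometric_le_lim => //.
  by rewrite gtr0_norm.
have := integrable_ae measurableT int_fin.
apply: filterS => w /(_ I) fw.
apply: cvg_series_cvg_0; apply: nondecreasing_is_cvgn.
  by apply: nondecreasing_series => n _ _; exact: S0.
exists (fine (\sum_(n <oo) (S n w)%:E)%E) => _ [n _ <-].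
rewrite -lee_fin fineK// /series /= -sumEFin.
by apply: nneseries_lim_ge => i _ _.
Qed.

Theorem mainTheorem6 (R : realType) (d : measure_display) (T : measurableType d)
  (P : probability T R) (H : R) (L Y : R -> T -> R) :
  1/2 < H < 1 ->
  levy_process P L ->
  no_gaussian_component P L ->
  P.-integrable setT (fun w => (L 1 w ^+ 2)%:E) ->
  ('E_P[L 1%R] = 0)%E ->
  (forall t, 0 <= t ->
     measurable_fun setT (Y t) /\ wiener_integral P L (zH H t) t (Y t)) ->
  forall t, 0 < t ->
  {ae P, forall w,
     (fun n : nat => \sum_(j < 2 ^ n)
        (Y (j.+1%:R * t / 2 ^+ n) w - Y (j%:R * t / 2 ^+ n) w) ^+ 2) @ \oo --> 0}.
Proof.
move=> H01 levyL _ L1 EL1 hY t t0; have /andP[H0 H1] := H01.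
have [c c0 cov] := levy_covariance levyL L1 EL1.
have sL s : 0 <= s -> square_integrable P (fun w => L s w - L 0 w).
  exact: levy_square_integrable.
have [C C0 hC] := integral_sum_sqr_zH_le H01 t0.
have p0 (n j : nat) : 0 <= j%:R * t / 2 ^+ n :> R.
  by rewrite divr_ge0 ?mulr_ge0 ?exprn_ge0// ltW.
pose a := H - 1/2.
have a0 : 0 < a by rewrite /a; lra.
have q0 : (0 : R) < 2^-1 `^ a by rewrite powR_gt0 ?invr_gt0.
have q1 : 2^-1 `^ a < (1 : R).
  rewrite -[ltRHS](_ : 1 `^ a = 1 :> R); last by rewrite powR1.
  by apply: gt0_ltr_powR; rewrite ?nnegrE ?invr_ge0// invf_lt1// ltr1n.
pose S n w := \sum_(j < 2 ^ n)
  (Y (j.+1%:R * t / 2 ^+ n) w - Y (j%:R * t / 2 ^+ n) w) ^+ 2.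
have mD n j : measurable_fun setT
    (fun w => (Y (j.+1%:R * t / 2 ^+ n) w - Y (j%:R * t / 2 ^+ n) w) ^+ 2).
  apply: measurable_funX; apply: measurable_funB.
    by case: (hY _ (p0 n j.+1)).
  by case: (hY _ (p0 n j)).
(* The rate [N^(-a)] with [a < 1/2] is not summable over all [N]; along [N = 2^n] it is geometric
   with ratio [2^(-a)]. *)
apply: (@ae_cvg0_summable_integral _ _ _ P S (9 * c * C) (2^-1 `^ a)).
- by move=> n; apply: measurable_sum => j; exact: mD.
- by move=> n w; apply: sumr_ge0 => j _; exact: sqr_ge0.
- by rewrite !mulr_ge0.
- by rewrite q0 q1.
move=> n.
have -> : (\int[P]_w (S n w)%:E = \sum_(j < 2 ^ n)
    \int[P]_w ((Y (j.+1%:R * t / 2 ^+ n) w - Y (j%:R * t / 2 ^+ n) w) ^+ 2)%:E)%E.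
  under eq_integral do rewrite -sumEFin.
  apply: ge0_integral_sum => //.
  - by move=> j; apply/measurable_EFinP; exact: mD.
  - by move=> j w _; rewrite lee_fin sqr_ge0.
pose dz (j : nat) v := zH H (j.+1%:R * t / 2 ^+ n) v - zH H (j%:R * t / 2 ^+ n) v.
apply: (@le_trans _ _ (\sum_(j < 2 ^ n) (9 * c)%:E *
    \int[@lebesgue_measure R]_v (dz j v ^+ 2)%:E)%E).
  apply: lee_sum => j _.
  have [m1 w1] := hY _ (p0 n j); have [m2 w2] := hY _ (p0 n j.+1).
  exact: (wiener_increment_le c0 sL cov m1 m2 w1 w2).
have dz0 j v : (0 <= (dz j v ^+ 2)%:E :> \bar R)%E by rewrite lee_fin sqr_ge0.
rewrite -ge0_sume_distrr; last by move=> j _; exact: integral_ge0.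
rewrite -ge0_integral_sum//; last first.
  move=> j; apply/measurable_EFinP; apply: measurable_funX.
  by apply: measurable_funB; exact: measurable_zH.
have := hC (2 ^ n)%N; rewrite expn_gt0 => /(_ isT) hn.
rewrite -[_ * C * _]mulrA [(9 * c * _)%:E]EFinM lee_wpmul2l ?lee_fin ?mulr_ge0//.
have -> : 2^-1 `^ a ^+ n = (2 ^ n)%:R^-1 `^ a :> R.
  by rewrite -powR_mulrn ?powR_ge0// powRAC powR_mulrn ?invr_ge0// exprVn natrX.
apply: le_trans hn; rewrite le_eqVlt; apply/orP; left; apply/eqP.
by apply: eq_integral => v _; rewrite sumEFin natrX.
Qed.
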